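(* Let $F$ and $E$ be two incommensurable Bedford-McMullen carpets with defining exponents $(m_1,n_1)$ and $(m_2,n_2)$, and let $\Gamma\subseteq[m_1]\times[n_1]$ be the allowed digit set of $F$. Assume that $\min_{i\in[n_1]}|\Gamma_i|>1$ and that $\dim^*E<2$. Then $F$ does not admit an affine embedding into $E$; that is, there is no invertible affine map $g:\mathbb{R}^2\to\mathbb{R}^2$ with $g(F)\subseteq E$.
   Context: For an integer $k\ge1$, $[k]:=\{0,\dots,k-1\}$. For integers $m>n\ge2$ and $\Gamma\subseteq[m]\times[n]$, the Bedford-McMullen carpet with defining exponents $(m,n)$ and allowed digit set $\Gamma$ is $F=\{(\sum_{k\ge1}x_k m^{-k},\sum_{k\ge1}y_k n^{-k}):(x_k,y_k)\in\Gamma\ \forall k\}$. Carpets are always assumed not to lie on a single vertical or horizontal line. For $i\in[n_1]$, $\Gamma_i:=\{a\in[m_1]:(a,i)\in\Gamma\}$. $F$ and $E$ are incommensurable if $\frac{\log m_1}{\log m_2},\frac{\log m_1}{\log n_2},\frac{\log n_1}{\log m_2},\frac{\log n_1}{\log n_2}$ are all irrational. Star dimension: for a compact set $A\subseteq[0,1]^2$, a miniset of $A$ is a non-empty closed set contained in $(a\cdot A+t)\cap[-1,1]^2$ for some $a\ge1$, $t\in\mathbb{R}^2$; a microset of $A$ is a limit, in the Hausdorff metric on non-empty closed subsets of $[-1,1]^2$, of minisets of $A$. Then $\dim^*A:=\sup\{\dim_H M: M\text{ is a microset of }A\}$. *)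

(* Defs.v *)
From mathcomp Require Import all_boot all_order all_algebra.
From mathcomp Require Import all_classical all_reals all_analysis.

Set Implicit Arguments.
Unset Strict Implicit.
Unset Printing Implicit Defensive.

Import Order.TTheory GRing.Theory Num.Theory.
Import numFieldNormedType.Exports.

Local Open Scope classical_set_scope.
Local Open Scope ring_scope.

Section Plane.
Context {R : realType}.
Implicit Types (A B M U : set 'rV[R]_2) (x y t : 'rV[R]_2).

(* The library norm on ['rV[R]_2] is the max norm; metric notions below use
   the Euclidean distance. *)
Definition eudist x y : R := Num.sqrt (\sum_i (x 0 i - y 0 i) ^+ 2).

(* Equals [-oo] on the empty set. *)
Definition diam U : \bar R :=
  ereal_sup [set (eudist x y)%:E | x in U & y in U].

(* The convention [0 `^ 0 = 1] makes singletons count for 1 when [s = 0]; the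
   empty set always counts for 0. *)
Definition diam_pow (s : R) U : \bar R :=
  if U == set0 then 0%E else (diam U `^ s)%E.

Definition hausdorff_premeasure (s d : R) A : \bar R :=
  ereal_inf [set (\sum_(k <oo) diam_pow s (U k))%E |
    U in [set U : (set 'rV[R]_2)^nat |
      A `<=` \bigcup_k U k /\ forall k, (diam (U k) <= d%:E)%E]].

Definition hausdorff_measure (s : R) A : \bar R :=
  ereal_sup [set hausdorff_premeasure s d A | d in [set d : R | 0 < d]].

Definition hausdorff_dim A : \bar R :=
  ereal_inf [set s%:E |
    s in [set s : R | 0 <= s /\ hausdorff_measure s A = 0%E]].

Definition hausdorff_excess A B : \bar R :=
  ereal_sup [set ereal_inf [set (eudist x y)%:E | y in B] | x in A].

Definition hausdorff_dist A B : \bar R :=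
  Order.max (hausdorff_excess A B) (hausdorff_excess B A).

Definition square11 : set 'rV[R]_2 :=
  [set x : 'rV[R]_2 | forall i, -1 <= x 0 i <= 1].

Definition miniset A M : Prop :=
  [/\ M !=set0, closed M &
    exists (a : R) t, 1 <= a /\
      M `<=` [set a *: x + t | x in A] `&` square11].

Definition microset A M : Prop :=
  [/\ M !=set0, closed M, M `<=` square11 &
    exists N : (set 'rV[R]_2)^nat,
      (forall k, miniset A (N k)) /\
      hausdorff_dist (N k) M @[k --> \oo] --> 0%E].

Definition star_dim A : \bar R :=
  ereal_sup [set hausdorff_dim M | M in [set M | microset A M]].

Definition invertible_affine (g : 'rV[R]_2 -> 'rV[R]_2) : Prop :=
  exists (L : 'M[R]_2) (b : 'rV[R]_2),
    L \in unitmx /\ forall x, g x = x *m L + b.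

Definition on_axis_parallel_line A : Prop :=
  exists (i : 'I_2) (c : R), forall x, A x -> x 0 i = c.

End Plane.

(* Digit sequences are indexed from 0, so digit number [k] has weight
   [b ^- k.+1]. *)
Definition base_expansion (R : realType) (b : nat) (x : nat -> 'I_b) : R :=
  limn (series (fun k => (x k)%:R * b%:R ^- k.+1 : R)).
Arguments base_expansion R {b} x.

Definition bm_point (R : realType) (m n : nat) (w : nat -> 'I_m * 'I_n) :
    'rV[R]_2 :=
  \row_(i < 2) if i == 0 then base_expansion R (fun k => (w k).1)
               else base_expansion R (fun k => (w k).2).
Arguments bm_point R {m n} w.

Definition bm_carpet (R : realType) (m n : nat) (Gamma : {set 'I_m * 'I_n}) :
    set 'rV[R]_2 :=
  [set bm_point R w |
    w in [set w : nat -> 'I_m * 'I_n | forall k, w k \in Gamma]].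
Arguments bm_carpet R {m n} Gamma.

(* [Gamma] is the allowed digit set of a Bedford-McMullen carpet with defining
   exponents [(m, n)], under the standing non-degeneracy assumption. *)
Definition bm_digits (R : realType) (m n : nat) (Gamma : {set 'I_m * 'I_n}) :
    Prop :=
  [/\ (2 <= n)%N, (n < m)%N & ~ on_axis_parallel_line (bm_carpet R Gamma)].
Arguments bm_digits R {m n} Gamma.

(* The set [Gamma_i] of digits allowed in row [i]. *)
Definition digit_row (m n : nat) (Gamma : {set 'I_m * 'I_n}) (i : 'I_n) :
    {set 'I_m} :=
  [set a | (a, i) \in Gamma].

Definition incommensurable (R : realType) (m1 n1 m2 n2 : nat) : Prop :=
  let log (k : nat) : R := ln k%:R in
  [/\ irrational (log m1 / log m2), irrational (log m1 / log n2),
      irrational (log n1 / log m2) & irrational (log n1 / log n2)].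

(* Main.v *)
(* Suppose [g] maps [F] into [E].  Changing the digit at position [j] of a point
   of [F], for varying [j], gives points of [E] of the form
   P + (c q^-j, O(q^-j)), or P + (O(q^-j), c q^-j), where q = m1 (two digits in
   the same row) or q = n1 (digits in two different rows) can be chosen so that
   c <> 0.  Multiplication by diag (m2^k, n2^k) acts on [E] modulo 1 as a shift.
   For r in {m2, n2}, [ln q / ln r] is irrational, so the leading base-q digits
   of c r^k can be prescribed; if they contain all words of a given length, then
   the numbers c r^k q^-j, for varying [j], are nearly dense modulo 1.  With
   r = n2 this shows that every row of [E] is inhabited.  With r = m2 the
   vertical displacements, of order n2^k q^-j, are negligible, so [E] is close
   to containing a full horizontal line, which forces a full row.  But then the
   unit square is a microset of [E], and the star dimension of [E] is 2. *)
Require Import Defs.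
From mathcomp Require Import all_boot all_order all_algebra.
From mathcomp Require Import all_classical all_reals all_analysis.
From mathcomp Require Import ring lra zify.

Import Order.TTheory GRing.Theory Num.Theory.
Import numFieldNormedType.Exports.

Local Open Scope classical_set_scope.
Local Open Scope ring_scope.

(** * Expansions in base [b] and their integer prefixes *)

Fixpoint prefix_value (b : nat) (x : nat -> 'I_b) (k : nat) : nat :=
  if k is k'.+1 then (prefix_value b x k' * b + x k')%N else 0%N.
Arguments prefix_value {b} x k.

Section BaseExpansion.
Context {R : realType} {b : nat}.
Implicit Types x : nat -> 'I_b.

Let term x : R ^nat := fun k => (x k)%:R * b%:R ^- k.+1.

Lemma base_gt0 x : (0 : R) < b%:R.
Proof. by rewrite ltr0n; case: (x 0%N) => m; apply: leq_ltn_trans. Qed.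

Lemma series_digits x n : series (term x) n = (prefix_value x n)%:R / b%:R ^+ n.
Proof.
have b0 := base_gt0 x; have bn0 : b%:R != 0 :> R by rewrite gt_eqF.
elim: n => [|n IH]; first by rewrite seriesEnat /= big_nil mul0r.
rewrite seriesSr IH /term /= natrD natrM exprS invfM.
by field; rewrite bn0 expf_neq0.
Qed.

Lemma prefix_value_lt x n : (prefix_value x n < b ^ n)%N.
Proof.
elim: n => [|n IH] //=; rewrite expnS mulnC.
have := ltn_ord (x n); nia.
Qed.

Lemma series_digits_le1 x n : series (term x) n <= 1.
Proof.
rewrite series_digits ler_pdivrMr ?exprn_gt0 ?base_gt0 ?mul1r// -natrX ler_nat.
exact/ltnW/prefix_value_lt.
Qed.

Lemma series_digits_ge0 x n : 0 <= series (term x) n.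
Proof. by rewrite series_digits divr_ge0// exprn_ge0. Qed.

Lemma is_cvg_series_digits x : cvgn (series (term x)).
Proof.
apply: nondecreasing_is_cvgn.
  apply/nondecreasing_seqP => n; rewrite seriesSr lerDl.
  by rewrite mulr_ge0// invr_ge0 exprn_ge0.
by exists 1 => _ [n _ <-]; exact: series_digits_le1.
Qed.

Lemma base_expansion_ge0 x : 0 <= base_expansion R x.
Proof.
apply: limr_ge; first exact: is_cvg_series_digits.
by apply: nearW => n; exact: series_digits_ge0.
Qed.

Lemma base_expansion_le1 x : base_expansion R x <= 1.
Proof.
apply: limr_le; first exact: is_cvg_series_digits.
by apply: nearW => n; exact: series_digits_le1.
Qed.

Lemma base_expansionS x : base_expansion R x =
  ((x 0%N)%:R + base_expansion R (fun k => x k.+1)) / b%:R.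
Proof.
have b0 := base_gt0 x; have bn0 : b%:R != 0 :> R by rewrite gt_eqF.
have cx : series (term x) @ \oo --> base_expansion R x.
  exact: is_cvg_series_digits.
rewrite -cvg_shiftS in cx.
apply: (cvg_unique _ cx) => //.
have e n : series (term x) n.+1 =
    ((x 0%N)%:R + series (term (fun k => x k.+1)) n) / b%:R.
  rewrite !seriesEnat /= big_nat_recl// mulrDl mulr_suml /term expr1.
  congr (_ + _); apply: eq_bigr => i _.
  by rewrite [b%:R ^+ i.+2]exprS invfM; ring.
have -> : (fun n => series (term x) n.+1) =
    (fun n => ((x 0%N)%:R + series (term (fun k => x k.+1)) n) / b%:R).
  exact/funext.
apply: cvgMl; apply: cvgD; first exact: cvg_cst.
exact: is_cvg_series_digits.
Qed.

Lemma base_expansion_shift x k : b%:R ^+ k * base_expansion R x =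
  (prefix_value x k)%:R + base_expansion R (fun i => x (k + i)%N).
Proof.
have b0 := base_gt0 x; have bn0 : b%:R != 0 :> R by rewrite gt_eqF.
elim: k => [|k IH] /=; first by rewrite mul1r add0r.
rewrite exprS -mulrA IH base_expansionS addn0 natrD natrM.
have -> : (fun i => x (k + i.+1)%N) = (fun i => x (k.+1 + i)%N).
  by apply/funext => i; rewrite addnS.
by field.
Qed.

(** Together with the upper bound below, this makes the prefix the floor of [b ^ k] times the
    number, unless the remaining tail equals 1. Strict inequalities are what later excludes this
    ambiguity. *)
Lemma prefix_value_le x k :
  (prefix_value x k)%:R <= b%:R ^+ k * base_expansion R x.
Proof. by rewrite base_expansion_shift lerDl base_expansion_ge0. Qed.

Lemma le_prefix_valueS x k :
  b%:R ^+ k * base_expansion R x <= (prefix_value x k)%:R + 1.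
Proof. by rewrite base_expansion_shift lerD2l base_expansion_le1. Qed.

Lemma base_expansion_update x (a : 'I_b) j :
  base_expansion R (fun k => if k == j then a else x k) =
  base_expansion R x + (a%:R - (x j)%:R) * b%:R ^- j.+1.
Proof.
have b0 := base_gt0 x; have bn0 : b%:R != 0 :> R by rewrite gt_eqF.
elim: j x => [|j IH] x; rewrite base_expansionS [in RHS]base_expansionS /=.
  by rewrite expr1; ring.
have -> : (fun k => if k.+1 == j.+1 then a else x k.+1) =
  (fun k => if k == j then a else x k.+1) by apply/funext => k; rewrite eqSS.
rewrite IH [b%:R ^+ j.+2]exprS invfM; ring.
Qed.

End BaseExpansion.

Lemma prefix_value_ext (b : nat) (x y : nat -> 'I_b) k :
  (forall i, (i < k)%N -> x i = y i) -> prefix_value x k = prefix_value y k.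
Proof.
elim: k => //= k IH xy; rewrite (xy k)// IH// => i ik.
exact/xy/ltnW.
Qed.

Lemma prefix_value_surj (b k N : nat) : (N < b ^ k)%N -> (0 < b)%N ->
  exists x : nat -> 'I_b, prefix_value x k = N.
Proof.
move=> + b0; elim: k N => [|k IH] N.
  by rewrite expn0 ltnS leqn0 => /eqP ->; exists (fun=> Ordinal b0).
rewrite expnSr => Nb; have [|x Nx] := IH (N %/ b)%N; first by rewrite ltn_divLR.
have Nb' : (N %% b < b)%N by rewrite ltn_mod.
exists (fun i => if i == k then Ordinal Nb' else x i) => /=.
rewrite eqxx /= [RHS](divn_eq N b) -Nx; congr (_ * _ + _)%N.
by apply: prefix_value_ext => i ik; rewrite ltn_eqF.
Qed.

(** * Density of irrational rotations of the circle *)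

Section Rotation.
Context {R : realType}.
Implicit Types alpha theta eps : R.

(** Pigeonhole: among the fractional parts of [i * alpha] for [0 <= i <= N], two share one of the
    [N] intervals of length [1 / N]; [k] is the difference of their indices. *)
Lemma dirichlet_approx alpha (N : nat) : (0 < N)%N ->
  exists k : nat, exists z : int,
    (0 < k)%N /\ `|k%:R * alpha - z%:~R| * N%:R < 1.
Proof.
case: N => // N _.
pose fr i : R := i%:R * alpha - (Num.floor (i%:R * alpha))%:~R.
have fr01 i : 0 <= fr i < 1.
  have /andP[] := floor_itv (i%:R * alpha); rewrite /fr intrD.
  by move=> ? ?; apply/andP; split; lra.
pose g i := Num.truncn (N.+1%:R * fr i).
have g_itv i : (g i)%:R <= N.+1%:R * fr i < (g i).+1%:R.
  apply: truncn_itv; rewrite mulr_ge0//; by case/andP: (fr01 i).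
have gN i : (g i < N.+1)%N.
  rewrite -(ltr_nat R); apply: le_lt_trans (andP (g_itv i)).1 _.
  by rewrite gtr_pMr//; case/andP: (fr01 i).
pose f (i : 'I_N.+2) := Ordinal (gN i).
have /injectivePn[i [j ij fij]] : ~~ injectiveb f.
  apply/negP => /injectiveP/leq_card; rewrite !card_ord; lia.
wlog ltij : i j ij fij / (i < j)%N.
  move=> H; case: (ltngtP i j) => [|ji|/val_inj /eqP]; first exact: H.
    by apply: (H j i) => //; rewrite eq_sym.
  by rewrite (negbTE ij).
exists (j - i)%N, (Num.floor (j%:R * alpha) - Num.floor (i%:R * alpha)).
rewrite subn_gt0 ltij; split => //.
have gij : g i = g j by case: fij.
have := g_itv i; have := g_itv j; rewrite gij -(natr1 (g j)).
move=> /andP[a1 a2] /andP[a3 a4].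
rewrite -[X in _ * X]ger0_norm ?ler0n// -normrM.
have -> : ((j - i)%N%:R * alpha -
    (Num.floor (j%:R * alpha) - Num.floor (i%:R * alpha))%:~R) * N.+1%:R =
    N.+1%:R * fr j - N.+1%:R * fr i.
  by rewrite natrB ?(ltnW ltij)// intrB /fr; ring.
by rewrite ltr_norml; apply/andP; split; lra.
Qed.

Lemma multiples_dense (d theta : R) (k0 : nat) : 0 < d ->
  exists k : nat, exists z : int,
    (k0 <= k)%N /\ `|k%:R * d - z%:~R - theta| <= d.
Proof.
move=> d0.
(* The integer shift makes [theta + Z] at least [k0 * d], so that its quotient by [d], rounded down,
   is at least [k0]. *)
pose Z := Num.ceil (k0%:R * d - theta).
have hZ : k0%:R * d - theta <= Z%:~R := ceil_ge _.
have h : k0%:R <= (theta + Z%:~R) / d by rewrite ler_pdivlMr//; lra.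
have h0 : 0 <= (theta + Z%:~R) / d by apply: le_trans h; exact: ler0n.
exists (Num.truncn ((theta + Z%:~R) / d)), Z.
have := truncn_itv h0; rewrite ler_pdivlMr// ltr_pdivrMr// -natr1.
move=> /andP[h1 h2].
split; last by rewrite ler_norml; apply/andP; split; lra.
by rewrite truncn_ge_nat.
Qed.

(** Dirichlet gives a multiple of [alpha] at signed distance [d] from an integer, with [|d| < eps];
    irrationality makes [d] nonzero, so its multiples sweep the circle in steps shorter than [eps].
    For negative [d] the target is reflected. *)
Lemma irrational_rotation_dense alpha theta eps (k0 : nat) :
  irrational alpha -> 0 < eps ->
  exists k : nat, exists z : int,
    (k0 <= k)%N /\ `|k%:R * alpha - z%:~R - theta| < eps.
Proof.
move=> irr eps0.
pose N := (Num.truncn eps^-1).+1.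
have [k1 [z1 [k10 hk1]]] := @dirichlet_approx alpha N isT.
pose d := k1%:R * alpha - z1%:~R.
have d0 : d != 0.
  apply/eqP => /eqP; rewrite subr_eq0 => /eqP dz; apply: irr.
  apply/rationalP; exists z1, k1; rewrite -dz mulrC mulKf//.
  by rewrite pnatr_eq0 -lt0n.
have d_eps : `|d| < eps.
  have : eps^-1 < N%:R by exact: truncnS_gt.
  rewrite -(ltr_pM2l eps0) mulfV ?gt_eqF// => h.
  have N0 : 0 < N%:R :> R by rewrite ltr0n.
  by rewrite -(ltr_pM2r N0) (lt_trans hk1).
have nd0 : 0 < `|d| by rewrite normr_gt0.
have [dgt|dlt|/eqP] := ltrgtP d 0; last by rewrite (negbTE d0).
- have [t [Z [tk0 ht]]] := multiples_dense _ (- theta) k0 nd0.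
  exists (t * k1)%N, (t%:Z * z1 - Z); split; first nia.
  apply: le_lt_trans d_eps; rewrite -normrN; apply: le_trans ht.
  rewrite le_eqVlt; apply/orP; left; apply/eqP; congr `|_|.
  rewrite ltr0_norm// /d natrM intrB intrM; ring.
- have [t [Z [tk0 ht]]] := multiples_dense _ theta k0 nd0.
  exists (t * k1)%N, (t%:Z * z1 + Z); split; first nia.
  apply: le_lt_trans d_eps; apply: le_trans ht.
  rewrite le_eqVlt; apply/orP; left; apply/eqP; congr `|_|.
  rewrite gtr0_norm// /d natrM intrD intrM; ring.
Qed.

End Rotation.

(** * Density modulo 1 of the numbers [c * r ^ k / q ^ j] for one well-chosen [k] *)

Section Dilates.
Context {R : realType}.
Implicit Types c eps y : R.

Lemma irrationalV (a : R) : irrational a -> irrational a^-1.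
Proof.
move=> + [s _ sa]; apply; exists s^-1 => //.
by rewrite -[RHS]invrK -sa fmorphV.
Qed.

Lemma ln_nat_gt0 (q : nat) : (1 < q)%N -> 0 < ln q%:R :> R.
Proof. by move=> q1; rewrite ln_gt0// ltr1n. Qed.

(** In logarithms to base [q] the claim is that [k * alpha - j] comes close to [theta], where
    [alpha = ln r / ln q]: an irrational rotation. Continuity of [expR] at 0 converts the error
    back. *)
Lemma exists_exp_ratio_near (q r : nat) c y eps : (1 < q)%N -> (1 < r)%N ->
  irrational (ln q%:R / ln r%:R : R) -> 0 < c -> 0 < y -> 0 < eps ->
  forall k0 j0 : nat, exists k j : nat,
    [/\ (k0 <= k)%N, (j0 <= j)%N & `|c * (r%:R ^+ k / q%:R ^+ j) - y| < eps].
Proof.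
move=> q1 r1 irr c0 y0 eps0 k0 j0.
have lq : 0 < ln q%:R :> R by exact: ln_nat_gt0.
have lr : 0 < ln r%:R :> R by exact: ln_nat_gt0.
have q0 : 0 < q%:R :> R by rewrite ltr0n ltnW.
have r0 : 0 < r%:R :> R by rewrite ltr0n ltnW.
have [e /= e0 he] : exists2 e : R, 0 < e &
    forall u, `|u| < e -> `|expR u - 1| < eps / y.
  have /cvgrPdist_lt/(_ _ (divr_gt0 eps0 y0)) := @continuous_expR R 0.
  rewrite expR0 => /nbhs_ballP[e /= e0 he]; exists e => // u ue.
  by rewrite distrC; apply: he; rewrite /ball /= sub0r normrN.
pose alpha := ln r%:R / ln q%:R : R.
have ia : irrational alpha.
  by rewrite /alpha -[_ / _]invf_div; exact: irrationalV.
have a0 : 0 < alpha by rewrite divr_gt0.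
pose theta := (ln y - ln c) / ln q%:R.
pose d := e / ln q%:R; have d0 : 0 < d by rewrite divr_gt0.
(* From [k1] on, the integer [z] near [k * alpha - theta] exceeds [j0]; in particular it is a
   natural number and can serve as the exponent [j]. *)
pose k1 := (Num.truncn ((j0%:R + theta + d) / alpha)).+1.
have hk1 : j0%:R + theta + d < k1%:R * alpha.
  by rewrite -ltr_pdivrMr//; exact: truncnS_gt.
have [k [z [kk hz]]] :=
  @irrational_rotation_dense R alpha theta d (maxn k0 k1) ia d0.
move: kk; rewrite geq_max => /andP[kk0 kk1].
have ka : k1%:R * alpha <= k%:R * alpha by rewrite ler_pM2r// ler_nat.
have zj : j0%:R < z%:~R :> R.
  by move: hz; rewrite ltr_norml => /andP[h1 h2]; lra.
have [j zE] : exists j : nat, z = j.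
  case: z zj {hz} => [j _|j]; first by exists j.
  rewrite NegzE mulrNz => h.
  have : (0 : R) < - j.+1%:R by apply: le_lt_trans h; exact: ler0n.
  by rewrite oppr_gt0 ltrn0.
exists k, j; split => //.
  by move: zj; rewrite zE -pmulrn ltr_nat => /ltnW.
set y' := c * _.
have y'0 : 0 < y' by rewrite mulr_gt0// divr_gt0// exprn_gt0.
have lny' : ln y' = ln c + (k%:R * ln r%:R - j%:R * ln q%:R).
  rewrite /y' lnM ?posrE ?divr_gt0 ?exprn_gt0//.
  by rewrite lnM ?lnV ?posrE ?invr_gt0 ?exprn_gt0// !lnXn// !mulr_natl.
have hu : `|ln y' - ln y| < e.
  have -> : ln y' - ln y = (k%:R * alpha - z%:~R - theta) * ln q%:R.
    by rewrite lny' zE -pmulrn /theta /alpha; field; rewrite gt_eqF.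
  by rewrite normrM (gtr0_norm lq) -ltr_pdivlMr.
have := he _ hu; rewrite expRB !lnK ?posrE// ltr_pdivlMr//.
rewrite -{2}(gtr0_norm y0) -normrM mulrBl mul1r divfK// gt_eqF//.
Qed.

(** In base [Q = q ^ l], let [y] have the digits 0, 1, ..., [Q - 1], repeated. The fractional
    expansion of [Q ^ d * y] then starts with the digit [d], so the first [Q] dilates come within
    [1 / Q] of every point modulo 1. *)
Lemma exists_dense_orbit (q l : nat) : (1 < q)%N -> (0 < l)%N -> exists y : R,
  0 < y <= 1 /\ forall theta : R, exists (d : nat) (z : int),
    (d < q ^ l)%N /\ `|(q ^ l)%:R ^+ d * y - z%:~R - theta| <= (q ^ l)%:R^-1.
Proof.
move=> q1 l0; set Q := (q ^ l)%N.
have Q1 : (1 < Q)%N by apply: leq_ltn_trans l0 (ltn_expl _ q1).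
have Q0 : (0 < Q)%N by apply: ltnW.
have QR : 0 < Q%:R :> R by rewrite ltr0n.
pose w d := Ordinal (ltn_pmod d Q0).
exists (base_expansion R w); rewrite base_expansion_le1 andbT; split.
  rewrite -(@pmulr_rgt0 _ (Q%:R ^+ 2)) ?exprn_gt0//.
  apply: lt_le_trans (prefix_value_le w 2) => /=.
  by rewrite !modn_small// ltr0n addn1.
move=> theta.
pose f := theta - (Num.floor theta)%:~R.
have /andP[f0 f1] : 0 <= f < 1.
  have /andP[] := floor_itv theta; rewrite /f intrD.
  by move=> ? ?; apply/andP; split; lra.
have fQ : 0 <= Q%:R * f by rewrite mulr_ge0// ltW.
pose d := Num.truncn (Q%:R * f).
have /andP[d1 d2] := truncn_itv fQ; rewrite -/d -natr1 in d1 d2.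
have dQ : (d < Q)%N.
  by rewrite -(ltr_nat R); apply: le_lt_trans d1 _; rewrite gtr_pMr.
exists d, ((prefix_value w d)%:Z - Num.floor theta); split => //.
rewrite base_expansion_shift base_expansionS addn0 /w /= modn_small//.
set t := base_expansion _ _.
have t0 : 0 <= t by exact: base_expansion_ge0.
have t1 : t <= 1 by exact: base_expansion_le1.
rewrite intrB -pmulrn -[leRHS]mul1r ler_pdivlMr//.
rewrite -[X in _ * X <= _](gtr0_norm QR) -normrM.
have -> : ((prefix_value w d)%:R + (d%:R + t) / Q%:R -
    ((prefix_value w d)%:R - (Num.floor theta)%:~R) - theta) * Q%:R =
    d%:R + t - Q%:R * f by rewrite /f; field; rewrite gt_eqF.
by rewrite ler_norml; apply/andP; split; lra.
Qed.

(** First [c * r ^ k / q ^ J] is brought so close to the point [y] of the previous lemma that the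
    error stays small after multiplication by any [Q ^ d] with [d < Q]. Lowering [J] by [l * d]
    performs this multiplication, so one [k] serves every [theta], and [B] is independent of
    [k0]. *)
Lemma dilates_dense_pos (q r : nat) c eps : (1 < q)%N -> (1 < r)%N ->
  irrational (ln q%:R / ln r%:R : R) -> 0 < c -> 0 < eps ->
  exists B : R, forall k0 : nat, exists2 k, (k0 <= k)%N &
    forall theta, exists (j : nat) (z : int), r%:R ^+ k / q%:R ^+ j <= B /\
      `|c * (r%:R ^+ k / q%:R ^+ j) - z%:~R - theta| < eps.
Proof.
move=> q1 r1 irr c0 eps0.
(* Then [Q > l > 2 / eps], which leaves room for two errors of size [1 / Q]: the approximation of
   [y] and the density of its orbit. *)
pose l := (Num.truncn (2 / eps)).+1.
have [y [/andP[y0 y1] yd]] := @exists_dense_orbit q l q1 isT.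
set Q := (q ^ l)%N in yd *.
have Ql : (l < Q)%N by exact: ltn_expl.
have Q1 : 1 <= Q%:R :> R by rewrite ler1n (leq_trans _ Ql).
have Q0 : 0 < Q%:R :> R by exact: lt_le_trans Q1.
have Qeps : 2 / Q%:R < eps.
  rewrite ltr_pdivrMr// mulrC -ltr_pdivrMr//.
  by apply: lt_trans (truncnS_gt _) _; rewrite ltr_nat.
pose M := Q%:R ^+ Q : R.
have M1 : 1 <= M by exact: exprn_ege1.
have M0 : 0 < M by exact: lt_le_trans M1.
have e0 : 0 < (M * Q%:R)^-1 by rewrite invr_gt0 mulr_gt0.
(* The dilates used are at most [Q ^ d * y + 1 / Q <= M + 1 <= 2 * M]. *)
exists (2 * M / c) => k0.
have [k [J [kk0 Jl hJ]]] :=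
  (* The bound [l * Q <= J] makes each [J - l * d] a genuine difference. *)
  @exists_exp_ratio_near q r c y _ q1 r1 irr c0 y0 e0 k0 (l * Q)%N.
exists k => // theta; have [d [z [dQ hd]]] := yd theta.
have ld : (l * d <= J)%N.
  by apply: leq_trans Jl; rewrite leq_mul2l (ltnW dQ) orbT.
exists (J - l * d)%N, z.
set y' := c * _ in hJ.
have QdM : Q%:R ^+ d <= M by rewrite /M ler_weXn2l// ltnW.
have Qd0 : 0 < Q%:R ^+ d :> R by rewrite exprn_gt0.
have q0 : q%:R != 0 :> R by rewrite pnatr_eq0 -lt0n ltnW.
have E : c * (r%:R ^+ k / q%:R ^+ (J - l * d)) = Q%:R ^+ d * y'.
  rewrite /y' /Q natrX -exprM -[in RHS](subnK ld) exprD.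
  by field; rewrite !expf_neq0.
have hM : `|Q%:R ^+ d * y' - Q%:R ^+ d * y| < Q%:R^-1.
  rewrite -mulrBr normrM (gtr0_norm Qd0).
  apply: (@le_lt_trans _ _ (M * `|y' - y|)); first exact: ler_wpM2r.
  have : M * `|y' - y| < M * (M * Q%:R)^-1 by rewrite ltr_pM2l.
  by rewrite invfM mulVKf// gt_eqF.
have Qi1 : Q%:R^-1 <= 1 :> R by rewrite invf_le1.
have Qdy : Q%:R ^+ d * y <= M by apply: le_trans QdM; rewrite ger_pMr.
split.
  rewrite ler_pdivlMr// mulrC E.
  by move: hM; rewrite ltr_norml => /andP[? ?]; lra.
rewrite E; move: hM hd; rewrite ltr_norml ler_norml ltr_norml.
by move=> /andP[? ?] /andP[? ?]; apply/andP; split; lra.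
Qed.

Lemma dilates_dense (q r : nat) c eps : (1 < q)%N -> (1 < r)%N ->
  irrational (ln q%:R / ln r%:R : R) -> c != 0 -> 0 < eps ->
  exists B : R, forall k0 : nat, exists2 k, (k0 <= k)%N &
    forall theta, exists (j : nat) (z : int), r%:R ^+ k / q%:R ^+ j <= B /\
      `|c * (r%:R ^+ k / q%:R ^+ j) - z%:~R - theta| < eps.
Proof.
move=> q1 r1 irr; rewrite neq_lt => /orP[c0|c0] eps0; last first.
  exact: dilates_dense_pos.
rewrite -oppr_gt0 in c0.
have [B hB] := @dilates_dense_pos q r _ eps q1 r1 irr c0 eps0.
exists B => k0; have [k kk0 hk] := hB k0; exists k => // theta.
have [j [z [hj hz]]] := hk (- theta); exists j, (- z); split => //.
by rewrite -normrN; congr (_ < _): hz; congr `|_|; rewrite mulrNz; ring.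
Qed.

End Dilates.

(** * Prescribing digits along a geometric family of carpet points *)

Lemma euclidean_digit_inj (b : nat) (z z' : int) (i i' : 'I_b) :
  z * b%:Z + i%:Z = z' * b%:Z + i'%:Z -> z = z' /\ i = i'.
Proof.
move=> e.
have b0 : (b%:Z != 0) by have := ltn_ord i; lia.
have small (j : 'I_b) : (j%:Z %% b%:Z)%Z = j%:Z.
  by rewrite modz_small//; have := ltn_ord j; lia.
have ii' : i = i'.
  apply/val_inj; have := congr1 (fun t => (t %% b%:Z)%Z) e.
  by rewrite !modzMDl !small => -[].
by split => //; move: e; rewrite ii' => /addIr/(mulIf b0).
Qed.

Lemma euclidean_digit (b : nat) (z : int) : (0 < b)%N ->
  exists (z' : int) (i : 'I_b), z = z' * b%:Z + i%:Z.
Proof.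
move=> b0; have bz : b%:Z != 0 by lia.
have h1 := modz_ge0 z bz; have h2 := ltz_pmod z (b0 : 0 < b%:Z).
have ib : (`|(z %% b%:Z)%Z| < b)%N by lia.
exists (z %/ b%:Z)%Z, (Ordinal ib) => /=.
by rewrite gez0_abs// -divz_eq.
Qed.

Section CarpetDigits.
Context {R : realType}.

(** Modulo 1, the numbers whose first two digits are [a], [a'] form a cell of length [b ^- 2]; the
    hypothesis places [b ^ k * x] strictly within half that length of its centre. Being in the open
    cell determines the prefix of length [k + 2]. *)
Lemma two_digitsP (b : nat) (x : nat -> 'I_b) (k : nat) (a a' : 'I_b)
    (z : int) :
  `|b%:R ^+ k * base_expansion R x
    - (z%:~R + (a%:R * b%:R + a'%:R + 2^-1) / b%:R ^+ 2)|
    < (2 * b%:R ^+ 2)^-1 ->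
  x k = a /\ x k.+1 = a'.
Proof.
have b0 : 0 < b%:R :> R by exact: base_gt0 x.
have h1 := @prefix_value_le R b x k.+2; have h2 := @le_prefix_valueS R b x k.+2.
set N := prefix_value x k.+2 in h1 h2.
pose D : int := (z * b%:Z + a%:Z) * b%:Z + a'%:Z.
rewrite ltr_norml => /andP[h3 h4].
have b20 : 0 < b%:R ^+ 2 :> R by rewrite exprn_gt0.
have DE : D%:~R = z%:~R * b%:R ^+ 2 + (a%:R * b%:R + a'%:R) :> R.
  by rewrite /D !(intrD, intrM) -!pmulrn; ring.
have E : b%:R ^+ k.+2 * base_expansion R x =
    b%:R ^+ 2 * (b%:R ^+ k * base_expansion R x) by rewrite -addn2 exprD; ring.
set X := b%:R ^+ k * _ in h3 h4 E.
have XE : b%:R ^+ 2 *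
      (X - (z%:~R + (a%:R * b%:R + a'%:R + 2^-1) / b%:R ^+ 2)) =
    b%:R ^+ 2 * X - D%:~R - 2^-1 by rewrite DE; field; rewrite gt_eqF.
have h5 : D%:~R < b%:R ^+ 2 * X.
  move: h3; rewrite -(ltr_pM2l b20).
  have -> : b%:R ^+ 2 * - (2 * b%:R ^+ 2)^-1 = - 2^-1 :> R.
    by field; rewrite gt_eqF.
  rewrite XE.
  lra.
have h6 : b%:R ^+ 2 * X < D%:~R + 1.
  move: h4; rewrite -(ltr_pM2l b20).
  have -> : b%:R ^+ 2 * (2 * b%:R ^+ 2)^-1 = 2^-1 :> R.
    by field; rewrite gt_eqF.
  rewrite XE.
  lra.
rewrite E in h1 h2.
have ND : N%:Z = D.
  have : N%:Z < D + 1 by rewrite -(ltr_int R) intrD -pmulrn; lra.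
  have : D < N%:Z + 1 by rewrite -(ltr_int R) intrD -pmulrn; lra.
  lia.
move: ND; rewrite /N /D /= !(PoszD, PoszM) => /euclidean_digit_inj[+ ->].
by move=> /euclidean_digit_inj[_ ->].
Qed.

(** The target is the centre of the cell of [a], [a'], corrected by [b ^ k * x0]. The order of
    quantifiers matters later: [B] precedes [k0], and [k] precedes the two digits. *)
Lemma hit_two_digits (b q : nat) (x0 c : R) (x : nat -> nat -> 'I_b) :
  (1 < b)%N -> (1 < q)%N -> irrational (ln q%:R / ln b%:R : R) -> c != 0 ->
  (forall j, base_expansion R (x j) = x0 + c / q%:R ^+ j) ->
  exists B : R, forall k0 : nat, exists2 k, (k0 <= k)%N &
    forall a a' : 'I_b, exists j,
      [/\ b%:R ^+ k / q%:R ^+ j <= B, x j k = a & x j k.+1 = a'].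
Proof.
move=> b1 q1 irr c0 hx.
have b0 : 0 < b%:R :> R by exact: base_gt0 (x 0%N).
have eps0 : 0 < (2 * b%:R ^+ 2)^-1 :> R.
  by rewrite invr_gt0 mulr_gt0// exprn_gt0.
have [B hB] := @dilates_dense R q b c _ q1 b1 irr c0 eps0.
exists B => k0; have [k kk0 hk] := hB k0; exists k => // a a'.
have [j [z [hj hz]]] :=
  hk ((a%:R * b%:R + a'%:R + 2^-1) / b%:R ^+ 2 - b%:R ^+ k * x0).
exists j; have [] := @two_digitsP b (x j) k a a' z; last by split.
rewrite hx; congr (_ < _): hz; congr `|_|; ring.
Qed.

Lemma exists_exprn_lt (a eps : R) : 0 <= a < 1 -> 0 < eps ->
  exists k0 : nat, forall k, (k0 <= k)%N -> a ^+ k < eps.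
Proof.
move=> /andP[a0 a1] eps0.
have /cvgrPdist_lt/(_ _ eps0)[k0 _ hk] :=
  @cvg_expr R a (eq_ind_r (fun t => t < 1) a1 (ger0_norm a0)).
exists k0 => k kk0; have := hk k kk0.
by rewrite /= sub0r normrN ger0_norm// exprn_ge0.
Qed.

Lemma rows_inhabited_of_geometric (m n q : nat) (Gamma : {set 'I_m * 'I_n})
    (y0 c : R) (w : nat -> nat -> 'I_m * 'I_n) :
  (1 < n)%N -> (1 < q)%N -> irrational (ln q%:R / ln n%:R : R) -> c != 0 ->
  (forall j k, w j k \in Gamma) ->
  (forall j, base_expansion R (fun k => (w j k).2) = y0 + c / q%:R ^+ j) ->
  forall i, exists a, (a, i) \in Gamma.
Proof.
move=> n1 q1 irr c0 wG wy i.
have [B hB] := @hit_two_digits n q y0 c _ n1 q1 irr c0 wy.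
have [k _ hk] := hB 0%N; have [j [_ ki _]] := hk i i.
by exists (w j k).1; rewrite -ki -surjective_pairing.
Qed.

(* The points of the family are horizontally dense modulo the grid at some
   scale, whereas vertically they stay within half a cell, hence in two adjacent
   rows of cells at most: a missing digit in each of them is used to describe a
   horizontal interval that the family should avoid. *)
Lemma full_row_of_geometric (m n q : nat) (Gamma : {set 'I_m * 'I_n})
    (x0 y0 c C : R) (w : nat -> nat -> 'I_m * 'I_n) :
  (0 < n < m)%N -> (1 < q)%N -> irrational (ln q%:R / ln m%:R : R) -> c != 0 ->
  (forall j k, w j k \in Gamma) ->
  (forall j, base_expansion R (fun k => (w j k).1) = x0 + c / q%:R ^+ j) ->
  (forall j, `|base_expansion R (fun k => (w j k).2) - y0| <= C / q%:R ^+ j) ->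
  exists i, forall a, (a, i) \in Gamma.
Proof.
move=> /andP[n0 nm] q1 irr c0 wG wx wy.
have m1 : (1 < m)%N by apply: leq_ltn_trans nm.
have nR : 0 < n%:R :> R by rewrite ltr0n.
have mR : 0 < m%:R :> R by rewrite ltr0n ltnW.
have qj j : 0 < q%:R ^+ j :> R by rewrite exprn_gt0// ltr0n ltnW.
apply: contrapT => /forallNP hG.
(* Here [f i] is a digit missing from row [i]. *)
have {hG} /choice[f hf] : forall i, exists a, (a, i) \notin Gamma.
  by move=> i; have /existsNP[a /negP ha] := hG i; exists a.
have [B hB] := @hit_two_digits m q x0 c _ m1 q1 irr c0 wx.
have C0 : 0 <= C.
  have := wy 0%N; rewrite expr0 divr1; exact: le_trans.
have ratio01 : 0 <= (n%:R / m%:R : R) < 1.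
  by rewrite divr_ge0//= ltr_pdivrMr// mul1r ltr_nat.
(* Chosen so that [(n / m) ^ k < 1 / D] bounds the vertical error [n ^ (k + 2) * C / q ^ j] by 1/2,
   given [m ^ k / q ^ j <= B]. *)
pose D := 2 * (n%:R ^+ 2 * (C * (`|B| + 1))) + 1 : R.
have D0 : 0 < D.
  by rewrite /D ltr_wpDl// !mulr_ge0// ?exprn_ge0// addr_ge0.
have Di0 : 0 < D^-1 by rewrite invr_gt0.
have [k0 hk0] := exists_exprn_lt _ _ ratio01 Di0.
have [k /hk0 hk {}hB] := hB k0.
pose t0 := n%:R ^+ k.+2 * y0.
(* The integer nearest to [t0]: a point within 1/2 of [t0] lies strictly between [S - 1] and
   [S + 1], so its vertical prefix of length [k + 2] is [S] or [S - 1]. *)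
pose S := Num.floor (t0 + 2^-1).
have /andP[S1 S2] := floor_itv (t0 + 2^-1); rewrite -/S intrD in S1 S2.
have [z1 [i2 SE]] := euclidean_digit n S n0.
have [z2 [i1 z1E]] := euclidean_digit n z1 n0.
have [z3 [i2' SE']] := euclidean_digit n (S - 1) n0.
(* One point defeats both cases. If the prefix is [S], its vertical digit at position [k] is [i1];
   if it is [S - 1], the one at position [k + 1] is [i2']. At each of these positions the horizontal
   digit is missing from that row. *)
have [j [jB ja ja']] := hB (f i1) (f i2').
have G1 := wG j k; have G2 := wG j k.+1.
have h1 := @prefix_value_le R n (fun k => (w j k).2) k.+2.
have h2 := @le_prefix_valueS R n (fun k => (w j k).2) k.+2.
set N := prefix_value _ k.+2 in h1 h2.
have close :
    `|n%:R ^+ k.+2 * base_expansion R (fun k => (w j k).2) - t0| < 2^-1.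
  rewrite -mulrBr normrM (gtr0_norm (exprn_gt0 _ nR)).
  apply: (@le_lt_trans _ _ (n%:R ^+ k.+2 * (C / q%:R ^+ j))).
    by rewrite ler_pM2l ?exprn_gt0//; exact: wy.
  have -> : n%:R ^+ k.+2 * (C / q%:R ^+ j) =
      (n%:R ^+ 2 * (C * (m%:R ^+ k / q%:R ^+ j))) * (n%:R / m%:R) ^+ k.
    rewrite -addn2 exprD expr_div_n; field.
    by rewrite (gt_eqF (qj j)) expf_neq0// gt_eqF.
  have mq0 : 0 <= m%:R ^+ k / q%:R ^+ j :> R.
    by rewrite divr_ge0// ?exprn_ge0// ltW.
  apply: (@le_lt_trans _ _ (2^-1 * D * (n%:R / m%:R) ^+ k)).
    have rk0 : 0 <= (n%:R / m%:R : R) ^+ k.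
      by case/andP: ratio01 => ? _; exact: exprn_ge0.
    rewrite ler_wpM2r//.
    have -> : 2^-1 * D = n%:R ^+ 2 * (C * (`|B| + 1)) + 2^-1.
      by rewrite /D; field.
    apply: (@le_trans _ _ (n%:R ^+ 2 * (C * (`|B| + 1)))); last by lra.
    rewrite ler_pM2l ?exprn_gt0// ler_wpM2l//.
    by apply: le_trans jB _; have := ler_norm B; lra.
  rewrite -mulrA gtr_pMr// mulrC -ltr_pdivlMr//.
  by rewrite mul1r.
move: close; rewrite ltr_norml => /andP[c1 c2].
have NS1 : N%:Z < S + 1 by rewrite -(ltr_int R) intrD -pmulrn; lra.
have NS2 : S - 2%:Z < N%:Z.
  by rewrite -(ltr_int R) intrB -!pmulrn; lra.
have NE : N%:Z = ((prefix_value (fun k => (w j k).2) k)%:Z * n%:Z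
    + (w j k).2%:Z) * n%:Z + (w j k.+1).2%:Z.
  by rewrite /N /= !(PoszD, PoszM).
have [NS|NS] : N%:Z = S \/ N%:Z = S - 1.
  by move: NS1 NS2; clear; move: (N%:Z) S => u v; lia.
- move: NS; rewrite NE SE => /euclidean_digit_inj[+ _].
  rewrite z1E => /euclidean_digit_inj[_ ki].
  by move: (hf i1); rewrite -ja -ki -surjective_pairing G1.
- move: NS; rewrite NE SE' => /euclidean_digit_inj[_ ki].
  by move: (hf i2'); rewrite -ja' -ki -surjective_pairing G2.
Qed.

End CarpetDigits.

(** * The unit square has Hausdorff dimension at least 2 *)

Section UnitSquare.
Context {R : realType}.

Definition unit_square : set 'rV[R]_2 :=
  [set x : 'rV[R]_2 | forall i, 0 <= x 0 i <= 1].

Lemma ord2E (i : 'I_2) : i = 0 \/ i = 1.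
Proof. by case: i => -[|[|//]] hi; [left|right]; exact: val_inj. Qed.

Lemma eudist_coord (x y : 'rV[R]_2) i : `|x 0 i - y 0 i| <= eudist x y.
Proof.
rewrite -sqrtr_sqr /eudist ler_sqrt ?sumr_ge0// => [|j _]; last exact: sqr_ge0.
by rewrite (bigD1 i)//= lerDl sumr_ge0// => j _; exact: sqr_ge0.
Qed.

Lemma eudist_le (x y : 'rV[R]_2) (e : R) : 0 <= e ->
  (forall i, `|x 0 i - y 0 i| <= e) -> eudist x y <= 2 * e.
Proof.
move=> e0 h; have e2 : 0 <= 2 * e by rewrite mulr_ge0.
rewrite -(ger0_norm e2) -sqrtr_sqr ler_sqrt ?sqr_ge0// big_ord_recl big_ord1.
have sq i : (x 0 i - y 0 i) ^+ 2 <= e ^+ 2.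
  by rewrite -(real_normK (num_real _)) lerXn2r ?nnegrE.
have := sq 0; have := sq (lift ord0 ord0); rewrite !expr2 => *; nra.
Qed.

Lemma eudist_xx (x : 'rV[R]_2) : eudist x x = 0.
Proof. by rewrite /eudist big1 ?sqrtr0// => i _; rewrite subrr expr0n. Qed.

Lemma diam_ge0 (U : set 'rV[R]_2) : U !=set0 -> (0 <= diam U)%E.
Proof.
move=> [x Ux]; apply: ereal_sup_ubound; exists x => //; exists x => //.
by rewrite eudist_xx.
Qed.

(** Countable subadditivity of planar Lebesgue measure, for squares of side [2 * r k]. *)
Lemma unit_square_cover_area (p : nat -> R * R) (r : nat -> R) :
  (forall k, 0 <= r k) ->
  `[0, 1]%classic `*` `[0, 1]%classic `<=`
    \bigcup_k (`[(p k).1 - r k, (p k).1 + r k]%classic `*`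
               `[(p k).2 - r k, (p k).2 + r k]%classic) ->
  (1 <= \sum_(k <oo) ((2 * r k) ^+ 2)%:E)%E.
Proof.
move=> r0 cov.
pose mu := @lebesgue_measure R.
have itv_le (a b : R) : a <= b -> mu `[a, b]%classic = (b - a)%:E.
  move=> ab; rewrite /mu lebesgue_measure_itv /= lte_fin EFinB.
  by case: ltgtP ab => // -> _; rewrite subee.
pose box k := `[(p k).1 - r k, (p k).1 + r k]%classic `*`
  `[(p k).2 - r k, (p k).2 + r k]%classic : set (R * R).
have area (a b c d : R) : a <= b -> c <= d ->
    (mu \x mu)%E (`[a, b]%classic `*` `[c, d]%classic) = ((b - a) * (d - c))%:E.
  move=> ab cd; rewrite product_measure1E// EFinM.
  by congr (_ * _)%E; exact: itv_le.
have : ((mu \x mu)%E (`[0%R, 1%R]%classic `*` `[0%R, 1%R]%classic) <=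
    \sum_(k <oo) (mu \x mu)%E (box k))%E.
  apply: measure_sigma_subadditive => //; last exact: measurableX.
  by move=> k; exact: measurableX.
have boxE k : (mu \x mu)%E (box k) = ((2 * r k) ^+ 2)%:E.
  by rewrite /box area; [congr _%:E; ring|have := r0 k; lra..].
by rewrite area// subr0 mulr1 (eq_eseriesr (fun k _ => boxE k)).
Qed.

Lemma sqr_le_diam_pow (s : R) (U : set 'rV[R]_2) : 0 <= s <= 2 ->
  U !=set0 -> (diam U <= 1)%E ->
  ((fine (diam U) ^+ 2)%:E <= diam_pow s U)%E.
Proof.
move=> /andP[s0 s2] U0 dU1; have dU0 := diam_ge0 _ U0.
rewrite /diam_pow ifF; last by apply/negbTE/set0P.
have dfin : diam U \is a fin_num.
  rewrite fin_numE -ltNye -ltey (lt_le_trans _ dU0) ?ltNyr//=.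
  by rewrite (le_lt_trans dU1) ?ltry.
rewrite -{2}(fineK dfin) poweR_EFin lee_fin.
have d0 : 0 <= fine (diam U) by exact: fine_ge0.
have d1 : fine (diam U) <= 1 by rewrite -lee_fin fineK.
have [->|dn0] := eqVneq (fine (diam U)) 0; first by rewrite expr0n powR_ge0.
rewrite -powR_mulrn//; apply: ger_powR => //.
by rewrite lt_neqAle eq_sym dn0 d0.
Qed.

(** A set of diameter [d <= 1] lies in a square of area [4 * d ^ 2 <= 4 * d ^ s] when [s < 2]. If
    the [s]-measure vanished, some cover would have [s]-sum below 1/8, hence total area below
    1/2. *)
Lemma hausdorff_dim_unit_square : (2%:E <= hausdorff_dim unit_square)%E.
Proof.
apply: le_ereal_inf_tmp => _ [s [s0 Hs] <-]; rewrite lee_fin.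
rewrite leNgt; apply/negP => s2.
have : (hausdorff_premeasure s 1 unit_square < (8^-1)%:E)%E.
  apply: (@le_lt_trans _ _ 0%E); last by rewrite lte_fin invr_gt0.
  by rewrite -[leRHS]Hs; apply: ereal_sup_ubound; exists 1 => //=; exact: ltr01.
move=> /ereal_inf_lt[_ [U [cov dU] <-]] sumU.
(* An empty set has diameter [-oo]; its radius is set to 0 explicitly. *)
pose r k := if U k == set0 then 0 else fine (diam (U k)).
have r0 k : 0 <= r k.
  rewrite /r; case: ifPn => // /set0P U0; exact/fine_ge0/diam_ge0.
have /choice[c hc] : forall k, exists c : 'rV[R]_2, U k !=set0 -> U k c.
  move=> k; have [[c Uc]|nU] := pselect (U k !=set0); first by exists c.
  by exists 0.
have := @unit_square_cover_area (fun k => (c k 0 0, c k 0 1)) r r0.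
apply/not_implyP; split.
  move=> [a b] /= [] /=; rewrite !in_itv /= => a01 b01.
  have [|k _ Uk] := cov (\row_(i < 2) if i == 0 then a else b).
    by move=> i; have [->|->] := ord2E i; rewrite mxE.
  have U0 : U k !=set0 by eexists; exact: Uk.
  have rE : r k = fine (diam (U k)) by rewrite /r ifF//; apply/negbTE/set0P.
  exists k => //=.
  have dist i : `|(\row_(i < 2) if i == 0 then a else b) 0 i - c k 0 i| <= r k.
    apply: le_trans (eudist_coord _ _ _) _.
    rewrite rE -lee_fin fineK; last first.
      rewrite fin_numE -ltNye -ltey (lt_le_trans _ (diam_ge0 _ U0)) ?ltNyr//=.
      by rewrite (le_lt_trans (dU k)) ?ltry.
    apply: ereal_sup_ubound; eexists; first exact: Uk.
    by exists (c k) => //; exact: hc.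
  have := dist 0; have := dist 1; rewrite !mxE /= !ler_norml !in_itv /=.
  by move=> /andP[? ?] /andP[? ?]; split; apply/andP; split; lra.
apply/negP; rewrite -ltNge.
apply: (@le_lt_trans _ _ (\sum_(k <oo) (4%:E * diam_pow s (U k)))%E).
  apply: lee_nneseries => k _; first by rewrite lee_fin sqr_ge0.
  rewrite exprMn EFinM; have -> : 2 ^+ 2 = 4 :> R by ring.
  apply: lee_pmul => //; rewrite ?lee_fin// ?sqr_ge0// /r.
  case: ifPn => [/eqP ->|/set0P U0]; first by rewrite /diam_pow eqxx expr0n.
  by apply: sqr_le_diam_pow => //; rewrite s0 ltW.
rewrite nneseriesZl => [|k _]; last first.
  by rewrite /diam_pow; case: ifP => // _; exact: poweR_ge0.
apply: (@lt_le_trans _ _ (4%:E * (8^-1)%:E)%E).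
  by rewrite lte_pmul2l// lte_fin.
by rewrite -EFinM lee_fin; lra.
Qed.

End UnitSquare.

(** * A full row and inhabited rows make the unit square a microset *)

Section StarDimension.
Context {R : realType}.

Lemma unit_square_closed : closed (@unit_square R).
Proof.
have -> : @unit_square R = (fun x : 'rV[R]_2 => x 0 0) @^-1` `[0, 1]%classic
    `&` (fun x : 'rV[R]_2 => x 0 1) @^-1` `[0, 1]%classic.
  apply/seteqP; split => [x hx|x [/= h0 h1] i].
    by split; rewrite /= in_itv /=; exact: hx.
  by rewrite !in_itv /= in h0 h1; have [->|->] := ord2E i.
by apply: closedI; apply: preimage_closed (@itv_closed _ _ _ _) => x _;
  exact: coord_continuous.
Qed.

(** The cell just left of the one containing [alpha] is taken (or cell 0), so that it lies entirely
    in the unit interval even if [1 / rho] is not an integer; this costs the factor 2. *)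
Lemma subdivision_cell (rho alpha : R) : 0 < rho <= 1 -> 0 <= alpha <= 1 ->
  exists N : nat, N.+1%:R * rho <= 1 /\
    forall t, 0 <= t <= 1 -> `|(N%:R + t) * rho - alpha| <= 2 * rho.
Proof.
move=> /andP[r0 r1] /andP[a0 a1].
have ar0 : 0 <= alpha / rho by rewrite divr_ge0// ltW.
have := truncn_itv ar0; rewrite ler_pdivlMr// ltr_pdivrMr//.
case: (Num.truncn _) => [|M] /andP[h1 h2].
  exists 0%N; rewrite mul1r; split => // t /andP[t0 t1].
  by rewrite ler_norml; apply/andP; split; nra.
exists M; split; first exact: le_trans h1 a1.
move=> t /andP[t0 t1]; rewrite -natr1 in h1; rewrite -!natr1 in h2.
by rewrite ler_norml; apply/andP; split; nra.
Qed.

Variables (m n : nat) (Gamma : {set 'I_m * 'I_n}) (i0 : 'I_n).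
Hypothesis n_gt1 : (1 < n)%N.
Hypothesis n_lt_m : (n < m)%N.
Hypothesis full_row : forall a, (a, i0) \in Gamma.
Hypothesis rows_inhabited : forall i, exists a, (a, i) \in Gamma.

Let nR : 0 < n%:R :> R. Proof. by rewrite ltr0n ltnW. Qed.
Let mR : 0 < m%:R :> R.
Proof. by rewrite ltr0n (leq_ltn_trans _ n_lt_m). Qed.

(* A carpet point whose first [k] digits lie in the full row and encode [N], and
   whose next [k] vertical digits encode [Q]: magnified by [n ^ k], its
   horizontal and vertical coordinates both become free up to a small error. *)
Let carpet_cell (k N Q : nat) : (N < m ^ k)%N -> (Q < n ^ k)%N ->
  exists w : nat -> 'I_m * 'I_n, exists t u : R,
  [/\ forall i, w i \in Gamma, 0 <= t <= 1 /\ 0 <= u <= 1,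
    n%:R ^+ k * bm_point R w 0 0 = (N%:R + t) * (n%:R / m%:R) ^+ k &
    n%:R ^+ k * bm_point R w 0 1 =
      (prefix_value (fun=> i0) k)%:R + (Q%:R + u) * (n%:R^-1) ^+ k].
Proof.
move=> /prefix_value_surj-/(_ (leq_ltn_trans (leq0n _) n_lt_m))[X XN].
move=> /prefix_value_surj-/(_ (ltnW n_gt1))[Y YQ].
have [f fG] := choice rows_inhabited.
pose w i := if (i < k)%N then (X i, i0) else (f (Y (i - k)%N), Y (i - k)%N).
pose t := base_expansion R (fun i => (w (k + i)%N).1).
pose u := base_expansion R (fun i => Y (k + i)%N).
exists w, t, u; split.
- by move=> i; rewrite /w; case: ifP.
- by rewrite !base_expansion_ge0 !base_expansion_le1.
- have := @base_expansion_shift R m (fun i => (w i).1) k.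
  rewrite -/t (@prefix_value_ext _ _ X) => [|i ik]; last by rewrite /w ik.
  rewrite XN mxE /= => <-; rewrite expr_div_n; field.
  by rewrite expf_neq0// gt_eqF.
- have := @base_expansion_shift R n (fun i => (w i).2) k.
  rewrite (@prefix_value_ext _ _ (fun=> i0)) => [|i ik]; last by rewrite /w ik.
  rewrite mxE /= => ->; congr (_ + _).
  have -> : (fun i => (w (k + i)%N).2) = Y.
    by apply/funext => i; rewrite /w ltnNge leq_addr /= addKn.
  rewrite -YQ -base_expansion_shift exprVn; field.
  by rewrite expf_neq0// gt_eqF.
Qed.

(** After magnification by [n ^ k], one carpet point is picked in each cell of a grid with steps
    [rx = (n / m) ^ k] and [ry = n ^- k]. A miniset may be any closed part of the magnified carpet,
    so this finite set qualifies. *)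
Lemma miniset_near_unit_square (eps : R) : 0 < eps ->
  exists M, miniset (bm_carpet R Gamma) M /\
    (hausdorff_dist M unit_square <= eps%:E)%E.
Proof.
move=> eps0.
have nm01 : 0 <= (n%:R / m%:R : R) < 1.
  by rewrite divr_ge0//= ltr_pdivrMr// mul1r ltr_nat.
have n01 : 0 <= (n%:R^-1 : R) < 1.
  by rewrite invr_ge0 ler0n /= invf_lt1// ltr1n.
(* A cell lies within [2 * rx] or [2 * ry], so below [eps / 2], in each coordinate; [eudist_le]
   doubles this. *)
have e40 : 0 < eps / 4 by rewrite divr_gt0.
have [k1 hk1] := exists_exprn_lt _ _ nm01 e40.
have [k2 hk2] := exists_exprn_lt _ _ n01 e40.
pose k := maxn k1 k2.
have /hk1 := leq_maxl k1 k2; have /hk2 := leq_maxr k1 k2; rewrite -/k.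
set rx := (_ / _) ^+ k; set ry := _ ^+ k => ry_small rx_small.
have rx01 : 0 < rx <= 1.
  case/andP: nm01 => ge0 /ltW le1.
  by rewrite exprn_gt0 ?divr_gt0//=; exact: exprn_ile1.
have ry01 : 0 < ry <= 1.
  case/andP: n01 => ge0 /ltW le1.
  by rewrite exprn_gt0 ?invr_gt0//=; exact: exprn_ile1.
have Nm N : N.+1%:R * rx <= 1 -> (N < m ^ k)%N.
  rewrite /rx expr_div_n mulrA ler_pdivrMr ?exprn_gt0// mul1r.
  rewrite -!natrX -natrM ler_nat.
  have nk : (0 < n ^ k)%N by rewrite expn_gt0 ltnW.
  exact/leq_trans/leq_pmulr.
have Qn Q : Q.+1%:R * ry <= 1 -> (Q < n ^ k)%N.
  by rewrite /ry exprVn ler_pdivrMr ?exprn_gt0// mul1r -natrX ler_nat.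
have cell (p : nat * nat) : exists v : 'rV[R]_2,
    (p.1.+1%:R * rx <= 1 /\ p.2.+1%:R * ry <= 1) ->
    exists t u : R, [/\ 0 <= t <= 1, 0 <= u <= 1, bm_carpet R Gamma v,
      n%:R ^+ k * v 0 0 = (p.1%:R + t) * rx &
      n%:R ^+ k * v 0 1 = (prefix_value (fun=> i0) k)%:R + (p.2%:R + u) * ry].
  have [[/Nm h1 /Qn h2]|h] :=
    pselect (p.1.+1%:R * rx <= 1 /\ p.2.+1%:R * ry <= 1).
    have [w [t [u [wG [t01 u01] wx wy]]]] := carpet_cell _ _ _ h1 h2.
    by exists (bm_point R w) => _; exists t, u; split => //; exists w.
  by exists 0 => /h.
have [v hv] := choice cell.
(* The translation cancels the vertical offset due to the prefix in row [i0]. *)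
pose b : 'rV[R]_2 := \row_(i < 2) if i == 0 then 0 else
  - (prefix_value (fun=> i0) k)%:R.
pose T : set (nat * nat) := (`I_(m ^ k) `*` `I_(n ^ k)) `&`
  [set p | p.1.+1%:R * rx <= 1 /\ p.2.+1%:R * ry <= 1].
pose g p := n%:R ^+ k *: v p + b.
have gE p : T p -> exists t u : R, [/\ 0 <= t <= 1, 0 <= u <= 1,
    bm_carpet R Gamma (v p), g p 0 0 = (p.1%:R + t) * rx &
    g p 0 1 = (p.2%:R + u) * ry].
  move=> [_ /hv[t [u [t01 u01 vG vx vy]]]]; exists t, u; split => //.
    by rewrite !mxE /= vx addr0.
  by rewrite !mxE /= vy addrAC subrr add0r.
have g_unit p : T p -> unit_square (g p).
  move=> Tp; have [t [u [/andP[t0 t1] /andP[u0 u1] _ gx gy]]] := gE _ Tp.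
  have [_ [h1 h2]] := Tp; rewrite -natr1 in h1; rewrite -natr1 in h2.
  have p10 := ler0n R p.1; have p20 := ler0n R p.2.
  case/andP: rx01 => rx0 _; case/andP: ry01 => ry0 _.
  by move=> i; have [->|->] := ord2E i; rewrite ?gx ?gy; apply/andP; split; nra.
have g_near x : unit_square x -> exists2 p, T p & eudist x (g p) <= eps.
  move=> hx.
  have [N [hN xN]] := subdivision_cell _ _ rx01 (hx 0).
  have [Q [hQ xQ]] := subdivision_cell _ _ ry01 (hx 1).
  have Tp : T (N, Q) by split; split => //=; [exact: Nm|exact: Qn].
  exists (N, Q) => //.
  have [t [u [t01 u01 _ gx gy]]] := gE _ Tp.
  have -> : eps = 2 * (eps / 2) by field.
  apply: eudist_le => [|i]; first by rewrite divr_ge0// ltW.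
  have hN' := xN t t01; have hQ' := xQ u u01.
  by have [->|->] := ord2E i; rewrite distrC ?gx ?gy /=; lra.
have T0 : T !=set0.
  have zero_square : unit_square (0 : 'rV[R]_2).
    by move=> i; rewrite mxE lexx ler01.
  by have [p Tp _] := g_near _ zero_square; exists p.
exists (g @` T); split.
- split.
  + by have [p Tp] := T0; exists (g p), p.
  + apply: (accessible_finite_set_closed.1 _).
      by apply: hausdorff_accessible; exact: norm_hausdorff.
    apply/finite_image/finite_setIl/finite_setX; exact: finite_II.
  + exists (n%:R ^+ k), b; split; first by rewrite exprn_ege1// ler1n ltnW.
    move=> _ [p Tp <-]; split.
      by have [t [u [_ _ vG _ _]]] := gE _ Tp; exists (v p).
    by move=> i; have /andP[h ->] := g_unit _ Tp i; rewrite andbT; lra.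
- rewrite ge_max; apply/andP; split; apply: ge_ereal_sup => _ [x Mx <-].
    apply: (@le_trans _ _ 0%E); last by rewrite lee_fin ltW.
    apply: ereal_inf_lbound; exists x; last by rewrite eudist_xx.
    by case: Mx => p Tp <-; exact: g_unit.
  have [p Tp hp] := g_near _ Mx.
  apply: (@le_trans _ _ (eudist x (g p))%:E); last by rewrite lee_fin.
  by apply: ereal_inf_lbound; exists (g p) => //; exists p.
Qed.

Lemma hausdorff_dist_ge0 (A B : set 'rV[R]_2) : A !=set0 ->
  (0 <= hausdorff_dist A B)%E.
Proof.
move=> [x Ax]; rewrite le_max; apply/orP; left.
apply: (@le_trans _ _ (ereal_inf [set (eudist x y)%:E | y in B])).
  by apply: le_ereal_inf_tmp => _ [y _ <-]; rewrite lee_fin sqrtr_ge0.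
by apply: ereal_sup_ubound; exists x.
Qed.

Lemma unit_square_microset : microset (bm_carpet R Gamma) unit_square.
Proof.
split; [|exact: unit_square_closed| |].
- by exists 0 => i; rewrite mxE lexx ler01.
- by move=> x hx i; have /andP[h ->] := hx i; rewrite andbT; lra.
have /choice[M hM] : forall k : nat, exists M, miniset (bm_carpet R Gamma) M /\
    (hausdorff_dist M unit_square <= (k.+1%:R^-1)%:E)%E.
  by move=> k; apply: miniset_near_unit_square; rewrite invr_gt0.
exists M; split; first by move=> k; case: (hM k).
apply: (@squeeze_cvge _ _ _ _ (cst 0%E) _ (fun k => (k.+1%:R^-1)%:E)).
- apply: nearW => k; have [[M0 _ _] hk] := hM k.
  by rewrite hausdorff_dist_ge0.
- exact: cvg_cst.
- apply: cvg_EFin; first exact: nearW.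
  exact: cvg_harmonic.
Qed.

Lemma star_dim_ge2 : (2%:E <= star_dim (bm_carpet R Gamma))%E.
Proof.
apply: le_trans hausdorff_dim_unit_square _.
apply: ereal_sup_ubound; exists unit_square => //; exact: unit_square_microset.
Qed.

End StarDimension.

(** * Geometric families in the target carpet produced by an embedding *)

Section Embedding.
Context {R : realType}.

Lemma bm_point0 (m n : nat) (w : nat -> 'I_m * 'I_n) :
  bm_point R w 0 0 = base_expansion R (fun k => (w k).1).
Proof. by rewrite mxE. Qed.

Lemma bm_point1 (m n : nat) (w : nat -> 'I_m * 'I_n) :
  bm_point R w 0 1 = base_expansion R (fun k => (w k).2).
Proof. by rewrite mxE. Qed.

(** The family consists of the images of the constant digit sequence [s] with its digit [j] replaced
    by [t]. Since vectors are rows, column [i] of [L] yields coordinate [i] of the displacement. *)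
Lemma embedded_digit_change (m1 n1 m2 n2 : nat) (Gamma1 : {set 'I_m1 * 'I_n1})
    (Gamma2 : {set 'I_m2 * 'I_n2}) (L : 'M[R]_2) (v : 'rV[R]_2)
    (s t : 'I_m1 * 'I_n1) :
  (forall x, bm_carpet R Gamma1 x -> bm_carpet R Gamma2 (x *m L + v)) ->
  s \in Gamma1 -> t \in Gamma1 ->
  exists (w : nat -> nat -> 'I_m2 * 'I_n2) (x0 y0 : R),
    let dx j := (t.1%:R - s.1%:R) / m1%:R ^+ j.+1 : R in
    let dy j := (t.2%:R - s.2%:R) / n1%:R ^+ j.+1 : R in
    [/\ forall j k, w j k \in Gamma2,
        forall j, base_expansion R (fun k => (w j k).1) =
                  x0 + (dx j * L 0 0 + dy j * L 1 0) &
        forall j, base_expansion R (fun k => (w j k).2) =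
                  y0 + (dx j * L 0 1 + dy j * L 1 1)].
Proof.
move=> emb sG tG.
pose p (j k : nat) := if k == j then t else s.
have /choice[w hw] : forall j, exists wj, (forall k, wj k \in Gamma2) /\
    bm_point R wj = bm_point R (p j) *m L + v.
  move=> j; have [|wj wjG wjE] := emb (bm_point R (p j)); last by exists wj.
  by exists (p j) => //= k; rewrite /p; case: ifP.
pose q := bm_point R (fun=> s) *m L + v.
exists w, (q 0 0), (q 0 1) => dx dy.
have p0 j : bm_point R (p j) 0 0 = bm_point R (fun=> s) 0 0 + dx j.
  rewrite !bm_point0 -(base_expansion_update (fun=> s.1) t.1 j).
  by congr base_expansion; apply/funext => k; rewrite /p; case: ifP.
have p1 j : bm_point R (p j) 0 1 = bm_point R (fun=> s) 0 1 + dy j.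
  rewrite !bm_point1 -(base_expansion_update (fun=> s.2) t.2 j).
  by congr base_expansion; apply/funext => k; rewrite /p; case: ifP.
have lin (x : 'rV[R]_2) i :
    (x *m L + v) 0 i = x 0 0 * L 0 i + x 0 1 * L 1 i + v 0 i.
  rewrite !mxE big_ord_recl big_ord1.
  by do 2 congr (_ + _); congr (x _ _ * L _ _); apply: val_inj.
split => [j k|j|j]; first exact: (hw j).1.
- by rewrite -bm_point0 (hw j).2 /q !lin p0 p1; ring.
- by rewrite -bm_point1 (hw j).2 /q !lin p0 p1; ring.
Qed.

Arguments embedded_digit_change {m1 n1 m2 n2 Gamma1 Gamma2 L v s t}.

Variables (m1 n1 m2 n2 : nat).
Variables (Gamma1 : {set 'I_m1 * 'I_n1}) (Gamma2 : {set 'I_m2 * 'I_n2}).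
Variables (L : 'M[R]_2) (v : 'rV[R]_2).
Hypothesis (n1_gt1 : (1 < n1)%N) (n1_lt_m1 : (n1 < m1)%N).
Hypothesis (n2_gt1 : (1 < n2)%N) (n2_lt_m2 : (n2 < m2)%N).
Hypothesis (inc : incommensurable R m1 n1 m2 n2).
Hypothesis (rows : forall i : 'I_n1, (1 < #|digit_row Gamma1 i|)%N).
Hypothesis (L_unit : L \in unitmx).
Hypothesis (emb :
  forall x, bm_carpet R Gamma1 x -> bm_carpet R Gamma2 (x *m L + v)).

Let m1_gt1 : (1 < m1)%N. Proof. exact: ltn_trans n1_lt_m1. Qed.

Let nat_ord_neq (b : nat) (i j : 'I_b) : i != j -> (i%:R - j%:R : R) != 0.
Proof. by rewrite subr_eq0 eqr_nat. Qed.

Let two_in_row : exists s t, [/\ s \in Gamma1, t \in Gamma1,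
  (t.1%:R - s.1%:R : R) != 0 & t.2 = s.2].
Proof.
have i : 'I_n1 := Ordinal (ltnW n1_gt1).
have /card_gt1P[a [a' []]] := rows i; rewrite !inE => aG aG' aa'.
by exists (a, i), (a', i); split => //=; rewrite nat_ord_neq// eq_sym.
Qed.

Let two_rows : exists s t, [/\ s \in Gamma1, t \in Gamma1 &
  (t.2%:R - s.2%:R : R) != 0].
Proof.
have row_ex i : exists a, (a, i) \in Gamma1.
  have /card_gt1P[a [_ [+ _ _]]] := rows i.
  by rewrite inE; exists a.
have [a aG] := row_ex (Ordinal (ltnW n1_gt1)).
have [a' aG'] := row_ex (Ordinal n1_gt1).
exists (a, Ordinal (ltnW n1_gt1)), (a', Ordinal n1_gt1).
by split => //; exact: nat_ord_neq.
Qed.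

(** An invertible matrix has no zero column: an image coordinate that ignores horizontal
    displacements detects vertical ones. *)
Let col_neq0 (j : 'I_2) : L 0 j = 0 -> L 1 j != 0.
Proof.
move=> L0; apply/eqP => L1; move: L_unit.
rewrite unitmxE unitfE (expand_det_col _ j) big1 ?eqxx// => i _.
by have [->|->] := ord2E i; rewrite ?L0 ?L1 mul0r.
Qed.

(** The vertical image displacement must be exactly geometric. If [L 0 1 != 0], two digits in one
    row give ratio [m1], with no vertical source term; if [L 0 1 = 0], digits in two rows give ratio
    [n1]. *)
Lemma embedding_rows_inhabited i : exists a, (a, i) \in Gamma2.
Proof.
have [_ i12 _ i22] := inc.
have [L0|L0] := eqVneq (L 0 1) 0.
  have [s [t [sG tG st]]] := two_rows.
  have [w [x0 [y0 [wG _ wy]]]] := embedded_digit_change emb sG tG.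
  apply: (@rows_inhabited_of_geometric R m2 n2 n1 Gamma2 y0
    ((t.2%:R - s.2%:R) / n1%:R * L 1 1) w) => //.
    by rewrite !mulf_neq0 ?col_neq0// invr_eq0 pnatr_eq0 -lt0n ltnW.
  by move=> j; rewrite wy L0 mulr0 add0r exprS invfM; ring.
have [s [t [sG tG st s2]]] := two_in_row.
have [w [x0 [y0 [wG _ wy]]]] := embedded_digit_change emb sG tG.
apply: (@rows_inhabited_of_geometric R m2 n2 m1 Gamma2 y0
  ((t.1%:R - s.1%:R) / m1%:R * L 0 1) w) => //.
  by rewrite !mulf_neq0// invr_eq0 pnatr_eq0 -lt0n ltnW.
by move=> j; rewrite wy s2 exprS invfM; ring.
Qed.

(** The same dichotomy, now on [L 0 0], makes the horizontal displacement geometric; the vertical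
    one only has to be bounded at the same rate. *)
Lemma embedding_full_row : exists i, forall a, (a, i) \in Gamma2.
Proof.
have [i11 _ i21 _] := inc.
have nm2 : (0 < n2 < m2)%N by rewrite ltnW.
have n10 : 0 < n1%:R :> R by rewrite ltr0n ltnW.
have m10 : 0 < m1%:R :> R by rewrite ltr0n ltnW.
have [L0|L0] := eqVneq (L 0 0) 0.
  have [s [t [sG tG st]]] := two_rows.
  have [w [x0 [y0 [wG wx wy]]]] := embedded_digit_change emb sG tG.
  apply: (@full_row_of_geometric R m2 n2 n1 Gamma2 x0 y0
    ((t.2%:R - s.2%:R) / n1%:R * L 1 0)
    (* The two vertical contributions decay like powers of [m1] and [n1]; as [n1 < m1], both are
       bounded at the rate [n1 ^- j]. *)
    (`|(t.1%:R - s.1%:R) * L 0 1| + `|(t.2%:R - s.2%:R) * L 1 1|) w) => //.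
  - by rewrite !mulf_neq0 ?col_neq0// invr_eq0 gt_eqF.
  - by move=> j; rewrite wx L0 mulr0 add0r exprS invfM; ring.
  - move=> j; rewrite wy [y0 + _]addrC addrK [leRHS]mulrDl.
    apply: le_trans (ler_normD _ _) _; apply: lerD.
      rewrite mulrAC normrM ler_wpM2l// ger0_norm ?invr_ge0 ?exprn_ge0//.
      rewrite lef_pV2 ?posrE ?exprn_gt0//.
      apply: (@le_trans _ _ (n1%:R ^+ j.+1)).
        by rewrite ler_weXn2l// ler1n ltnW.
      by rewrite lerXn2r ?nnegrE ?ler_nat// ltnW.
    rewrite mulrAC normrM ler_wpM2l// ger0_norm ?invr_ge0 ?exprn_ge0//.
    rewrite lef_pV2 ?posrE ?exprn_gt0//.
    by rewrite ler_weXn2l// ler1n ltnW.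
have [s [t [sG tG st s2]]] := two_in_row.
have [w [x0 [y0 [wG wx wy]]]] := embedded_digit_change emb sG tG.
apply: (@full_row_of_geometric R m2 n2 m1 Gamma2 x0 y0
  ((t.1%:R - s.1%:R) / m1%:R * L 0 0)
  `|(t.1%:R - s.1%:R) / m1%:R * L 0 1| w) => //.
- by rewrite !mulf_neq0// invr_eq0 gt_eqF.
- by move=> j; rewrite wx s2 exprS invfM; ring.
- move=> j; rewrite wy s2 [y0 + _]addrC addrK subrr !mul0r addr0 exprS invfM.
  rewrite -[X in _ <= _ / X]ger0_norm ?exprn_ge0// -normfV -normrM.
  by rewrite le_eqVlt; apply/orP; left; apply/eqP; congr `|_|; ring.
Qed.

End Embedding.

Arguments embedding_rows_inhabited {R m1 n1 m2 n2 Gamma1 Gamma2 L v}.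
Arguments embedding_full_row {R m1 n1 m2 n2 Gamma1 Gamma2 L v}.

Theorem theorem1p6 (R : realType) (m1 n1 m2 n2 : nat)
    (Gamma1 : {set 'I_m1 * 'I_n1}) (Gamma2 : {set 'I_m2 * 'I_n2})
    (hF : bm_digits R Gamma1) (hE : bm_digits R Gamma2)
    (hinc : incommensurable R m1 n1 m2 n2)
    (hrows : forall i : 'I_n1, (1 < #|digit_row Gamma1 i|)%N)
    (hstar : (star_dim (bm_carpet R Gamma2) < 2%:E)%E) :
  ~ exists g : 'rV[R]_2 -> 'rV[R]_2,
      invertible_affine g /\ g @` bm_carpet R Gamma1 `<=` bm_carpet R Gamma2.
Proof.
move=> [g [[L [v [Lu gE]]] gFE]].
have [n1_gt1 n1_lt_m1 _] := hF; have [n2_gt1 n2_lt_m2 _] := hE.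
have emb x : bm_carpet R Gamma1 x -> bm_carpet R Gamma2 (x *m L + v).
  by move=> Fx; rewrite -gE; apply: gFE; exists x.
have rows2 :=
  embedding_rows_inhabited n1_gt1 n1_lt_m1 n2_gt1 hinc hrows Lu emb.
have [i0 full] :=
  embedding_full_row n1_gt1 n1_lt_m1 n2_gt1 n2_lt_m2 hinc hrows Lu emb.
have := @star_dim_ge2 R m2 n2 Gamma2 i0 n2_gt1 n2_lt_m2 full rows2.
by move=> /le_lt_trans/(_ hstar); rewrite ltxx.
Qed.
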